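(* Every Inoue surface modeled on $Sol^4_1$, i.e. every compact quotient $M$ of the Lie group $Sol_1^4$ by a discrete subgroup $\Gamma$, admits a hyper-paracomplex structure such that the corresponding neutral metric is anti-self-dual and not Weyl flat, and such that the corresponding hyper-paraHermitian structure is locally, but not globally, conformally hyper-paraKähler (hypersymplectic).
   Context: $Sol^4_1$ is the simply connected solvable 4-dimensional Lie group whose Lie algebra has a basis $X,Y,Z,W$ with non-zero brackets $[X,Y]=Z$, $[X,W]=X$, $[W,Y]=Y$. A hyper-paracomplex structure on a 4-manifold is a triple $(J_1,J_2,J_3)$ of endomorphisms of $TM$ with $J_1^2=J_2^2=-J_3^2=\mathrm{id}$, $J_1J_2=-J_2J_1=J_3$, each of which is integrable (vanishing Nijenhuis tensor). A metric $g$ is compatible with it if $g(J_1\cdot,J_1\cdot)=g(J_2\cdot,J_2\cdot)=-g(J_3\cdot,J_3\cdot)=-g(\cdot,\cdot)$; such metrics have neutral signature $(2,2)$, form a conformal class in dimension 4, and $(g,J_1,J_2,J_3)$ is called a hyper-paraHermitian structure. The orientation is the one for which the 2-forms $F_\alpha(X,Y)=g(X,J_\alpha Y)$ are self-dual; $g$ is anti-self-dual if the self-dual part $W^+$ of its Weyl tensor vanishes, and not Weyl flat if its Weyl tensor is not identically zero. The structure is hyper-paraKähler (hypersymplectic) if $J_1,J_2,J_3$ are all parallel for the Levi-Civita connection of $g$; it is locally (globally) conformally hyper-paraKähler if locally (globally) there is a function $u$ such that $(e^{u}g,J_1,J_2,J_3)$ is hyper-paraKähler. *)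

(* Defs.v *)
From HB Require Import structures.
From mathcomp Require Import all_boot all_order all_algebra.
From mathcomp Require Import all_classical all_reals all_analysis.
From mathcomp Require Import ring lra.

Set Implicit Arguments.
Unset Strict Implicit.
Unset Printing Implicit Defensive.

Import Order.TTheory GRing.Theory Num.Theory.
Import numFieldNormedType.Exports.

Local Open Scope classical_set_scope.
Local Open Scope ring_scope.

Lemma sum_ord4 (V : zmodType) (F : 'I_4 -> V) :
  \sum_k F k = F 0 + F 1 + F 2 + F 3.
Proof.
rewrite !big_ord_recl big_ord0 addr0 !addrA.
by congr (_ + _ + _ + _); congr F; apply: val_inj.
Qed.

(* Sol^4_1 is realised on R^4, with coordinates (x, y, z, w), by
     (x,y,z,w) (x',y',z',w')
       = (x + e^{-w} x', y + e^w y', z + z' + e^w x y', w + w').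
   The lemmas [frame_expr] and [frame_bracket] below show that its
   left-invariant fields X, Y, Z, W (the ones equal to d/dx, d/dy, d/dz, d/dw
   at the identity) satisfy [X,Y] = Z, [X,W] = X, [W,Y] = Y. *)
Section Group.
Context {R : realType}.
Implicit Types p q r : 'rV[R]_4.

Definition row4 (x y z w : R) : 'rV[R]_4 := \row_i [:: x; y; z; w]`_i.

Definition sol4_mul p q : 'rV[R]_4 :=
  row4 (p 0 0 + expR (- p 0 3) * q 0 0)
       (p 0 1 + expR (p 0 3) * q 0 1)
       (p 0 2 + q 0 2 + expR (p 0 3) * p 0 0 * q 0 1)
       (p 0 3 + q 0 3).

Definition sol4_one : 'rV[R]_4 := 0.

Definition sol4_inv p : 'rV[R]_4 :=
  row4 (- (expR (p 0 3) * p 0 0))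
       (- (expR (- p 0 3) * p 0 1))
       (p 0 0 * p 0 1 - p 0 2)
       (- p 0 3).

Definition frame (i : 'I_4) p : 'rV[R]_4 :=
  'D_(delta_mx 0 i) (sol4_mul p) sol4_one.

(* [e_i, e_j] = \sum_k sol4_cst i j k e_k, where (e_0,e_1,e_2,e_3) = (X,Y,Z,W) *)
Definition sol4_cst (i j k : 'I_4) : R :=
  if (i, j, k) \in [:: (0, 1, 2); (0, 3, 0); (3, 1, 1)] then 1
  else if (j, i, k) \in [:: (0, 1, 2); (0, 3, 0); (3, 1, 1)] then - 1
  else 0.

Lemma sol4_cst_skew i j k : sol4_cst i j k = - sol4_cst j i k.
Proof.
rewrite /sol4_cst; case: ifP => [|_]; case: ifP => [|_]; rewrite ?opprK ?oppr0//.
by rewrite !inE => /or3P[] /eqP[-> -> ->].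
Qed.

Lemma row4P p q : [/\ p 0 0 = q 0 0, p 0 1 = q 0 1, p 0 2 = q 0 2
  & p 0 3 = q 0 3] -> p = q.
Proof.
move=> [h0 h1 h2 h3]; apply/rowP; case=> -[|[|[|[|//]]]] hi.
- by rewrite (_ : Ordinal hi = 0) //; apply: val_inj.
- by rewrite (_ : Ordinal hi = 1) //; apply: val_inj.
- by rewrite (_ : Ordinal hi = 2) //; apply: val_inj.
- by rewrite (_ : Ordinal hi = 3) //; apply: val_inj.
Qed.

Lemma row4E x y z w : (row4 x y z w 0 0 = x) * (row4 x y z w 0 1 = y) *
  (row4 x y z w 0 2 = z) * (row4 x y z w 0 3 = w).
Proof. by rewrite !mxE. Qed.

Lemma sol4_mul1 p : sol4_mul p sol4_one = p.
Proof. by apply: row4P; rewrite !row4E !mxE; split; ring. Qed.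

Lemma sol4_1mul p : sol4_mul sol4_one p = p.
Proof. by apply: row4P; rewrite !row4E !mxE oppr0 expR0; split; ring. Qed.

Lemma sol4_mulA p q r : sol4_mul p (sol4_mul q r) = sol4_mul (sol4_mul p q) r.
Proof. have h := expRxMexpNx_1 (p 0 3).
by apply: row4P; rewrite /sol4_mul !row4E opprD !expRD; split; ring: h. Qed.

Lemma sol4_mulV p : sol4_mul p (sol4_inv p) = sol4_one.
Proof.
have h := expRxMexpNx_1 (p 0 3).
by apply: row4P; rewrite !row4E !mxE; split; ring: h.
Qed.

Lemma sol4_mulVl p : sol4_mul (sol4_inv p) p = sol4_one.
Proof.
have h := expRxMexpNx_1 (p 0 3).
by apply: row4P; rewrite !row4E !mxE opprK; split; ring: h.
Qed.

Lemma sol4_mul_affine (a p v : 'rV[R]_4) (t : R) :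
  sol4_mul a (p + t *: v) = sol4_mul a p + t *: (sol4_mul a v - a).
Proof. by apply: row4P; rewrite !(row4E, mxE) /=; split; ring. Qed.

Lemma derive_sol4_mul (a p v : 'rV[R]_4) :
  'D_v (sol4_mul a) p = sol4_mul a v - a.
Proof.
apply: cvg_lim => //; apply: cvg_near_cst; near=> h => /=.
have h0 : h != 0 by near: h; exact: nbhs_dnbhs_neq.
rewrite [h *: v + p]addrC sol4_mul_affine addrAC subrr add0r.
by rewrite scalerA mulVf// scale1r.
Unshelve. all: by end_near. Qed.

Lemma frame_mul (i : 'I_4) p : frame i p = sol4_mul p (delta_mx 0 i) - p.
Proof. exact: derive_sol4_mul. Qed.

Lemma frame_invariant (i : 'I_4) p q :
  frame i (sol4_mul p q) = 'D_(frame i q) (sol4_mul p) q.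
Proof.
have := sol4_mul_affine p q (frame i q) 1; rewrite !scale1r derive_sol4_mul.
by rewrite !frame_mul addrC subrK sol4_mulA => ->; rewrite addrC addKr.
Qed.

Lemma frame_expr p :
  [/\ frame 0 p = row4 (expR (- p 0 3)) 0 0 0,
      frame 1 p = row4 0 (expR (p 0 3)) (expR (p 0 3) * p 0 0) 0,
      frame 2 p = row4 0 0 1 0
    & frame 3 p = row4 0 0 0 1].
Proof.
by split; rewrite frame_mul; apply: row4P;
  rewrite /sol4_mul !(row4E, mxE) /= ?mulr1n ?mulr0n; split; ring.
Qed.

Lemma is_derive_line (f : 'rV[R]_4 -> R) p v (l : R) :
  is_derive (0 : R) 1 (fun h => f (h *: v + p)) l -> is_derive p v f l.
Proof.
have E : (fun h : R => h^-1 *: (((fun h => f (h *: v + p)) \o shift 0) (h *: 1)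
      - f (0 *: v + p))) = fun h => h^-1 *: ((f \o shift p) (h *: v) - f p).
  by apply/funext => h /=; rewrite addr0 scale0r add0r /GRing.scale /= mulr1.
by case; rewrite /derivable /derive /= E => h1 h2; split.
Qed.

Lemma is_derive_row4 (f0 f1 f2 f3 : 'rV[R]_4 -> R) p v (l0 l1 l2 l3 : R) :
  is_derive p v f0 l0 -> is_derive p v f1 l1 ->
  is_derive p v f2 l2 -> is_derive p v f3 l3 ->
  'D_v (fun q => row4 (f0 q) (f1 q) (f2 q) (f3 q)) p = row4 l0 l1 l2 l3.
Proof.
move=> [d0 e0] [d1 e1] [d2 e2] [d3 e3].
rewrite derive_mx.
  apply: row4P; rewrite !row4E !mxE -e0 -e1 -e2 -e3.
  by split; congr ('D_v _ p); apply/funext => q; rewrite row4E.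
apply/derivable_mxP => i j; rewrite ord1.
rewrite (_ : (fun _ => _) = nth f0 [:: f0; f1; f2; f3] j).
  case: j => -[|[|[|[|k]]]] hj;
    [exact: d0 | exact: d1 | exact: d2 | exact: d3 | discriminate hj].
apply/funext => q; rewrite mxE.
by case: j => -[|[|[|[|k]]]] hj; [| | | | discriminate hj].
Qed.

Lemma frame_bracket (i j : 'I_4) p :
  'D_(frame i p) (frame j) p - 'D_(frame j p) (frame i) p =
  \sum_k sol4_cst i j k *: frame k p.
Proof.
have F k : frame k = nth (fun=> 0) [::
    fun q => row4 (expR (- q 0 3)) 0 0 0;
    fun q => row4 0 (expR (q 0 3)) (expR (q 0 3) * q 0 0) 0;
    fun=> row4 0 0 1 0; fun=> row4 0 0 0 1] k.
  apply/funext => q; have [f0 f1 f2 f3] := frame_expr q.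
  by case: k => -[|[|[|[|//]]]] hi /=; rewrite -?f0 -?f1 -?f2 -?f3;
    congr (frame _ q); apply: val_inj.
have X v : is_derive p v (fun q => q 0 0) (v 0 0).
  apply: is_derive_line; under eq_fun do rewrite !mxE.
  by apply: is_derive_eq; rewrite scaler0 add0r addr0 scaler1.
have E v : is_derive p v (fun q => expR (q 0 3)) (v 0 3 * expR (p 0 3)).
  apply: is_derive_line; under eq_fun do rewrite !mxE.
  apply: is_derive_eq.
  by rewrite scaler0 add0r addr0 scaler1 mul0r add0r mulrC.
have E' v : is_derive p v (fun q => expR (- q 0 3)) (- v 0 3 * expR (- p 0 3)).
  apply: is_derive_line; under eq_fun do rewrite !mxE.
  apply: is_derive_eq.
  by rewrite scaler0 add0r addr0 scaler1 mul0r add0r mulrC.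
have C v (c : R) : is_derive p v (fun=> c) 0 by exact: is_derive_cst.
have EX v := is_deriveM (E v) (X v).
have D v k : 'D_v (frame k) p = nth 0 [::
    row4 (- v 0 3 * expR (- p 0 3)) 0 0 0;
    row4 0 (v 0 3 * expR (p 0 3))
           (expR (p 0 3) * v 0 0 + p 0 0 * (v 0 3 * expR (p 0 3))) 0;
    0; 0] k.
  rewrite F; case: k => -[|[|[|[|//]]]] hi /=; rewrite ?derive_cst//.
    exact: is_derive_row4.
  exact: (is_derive_row4 (C _ _) (E _) (EX _) (C _ _)).
have h := expRxMexpNx_1 (p 0 3).
have [f0 f1 f2 f3] := frame_expr p.
rewrite sum_ord4.
rewrite [X in X - _ = _](D (frame i p) j) [X in _ - X = _](D (frame j p) i).
rewrite !f0 f1 f2 f3 !F /sol4_cst; clear -h.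
case: i => -[|[|[|[|i]]]] hi; [| | | | discriminate hi];
case: j => -[|[|[|[|j]]]] hj; try discriminate hj;
  rewrite /=; apply: row4P; rewrite !mxE /=.
all: by split; ring: h.
Qed.

End Group.

Section Subgroup.
Context {R : realType}.

Record discrete_subgroup := DiscreteSubgroup {
  dsubgroup_set : set 'rV[R]_4;
  dsubgroup_one : dsubgroup_set sol4_one;
  dsubgroup_mul : forall a b, dsubgroup_set a -> dsubgroup_set b ->
    dsubgroup_set (sol4_mul a b);
  dsubgroup_inv : forall a, dsubgroup_set a -> dsubgroup_set (sol4_inv a);
  dsubgroup_discrete : dsubgroup_set `<=` isolated dsubgroup_set
}.
End Subgroup.

Arguments discrete_subgroup R : clear implicits.

Section Quotient.
Context {R : realType} (Gamma : discrete_subgroup R).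
Implicit Types p q : 'rV[R]_4.

Definition same_coset p q : bool :=
  `[< exists2 a, dsubgroup_set Gamma a & q = sol4_mul a p >].

Lemma same_coset_refl : reflexive same_coset.
Proof.
move=> p; apply/asboolP; exists sol4_one; first exact: dsubgroup_one.
by rewrite sol4_1mul.
Qed.

Lemma same_coset_sym : symmetric same_coset.
Proof.
move=> p q; apply/asboolP/asboolP => -[a Ga ->]; exists (sol4_inv a);
  by [exact: dsubgroup_inv | rewrite sol4_mulA sol4_mulVl sol4_1mul].
Qed.

Lemma same_coset_trans : transitive same_coset.
Proof.
move=> q p r /asboolP[a Ga ->] /asboolP[b Gb ->]; apply/asboolP.
by exists (sol4_mul b a); [exact: dsubgroup_mul | rewrite sol4_mulA].
Qed.

Definition same_coset_equiv :=
  EquivRel same_coset same_coset_refl same_coset_sym same_coset_trans.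

Definition sol4_quotient : Type :=
  quotient_topology {eq_quot same_coset_equiv}%qT.
HB.instance Definition _ := Topological.on sol4_quotient.


Definition sol4_proj (p : 'rV[R]_4) : sol4_quotient :=
  (\pi_(sol4_quotient) p)%qT.

(* The left-invariant fields e_i descend to the quotient, as [frame_derE]
   states, so they trivialise its tangent bundle.  Tensor fields on the quotient
   are given below by their components in this frame: a vector field is a
   function into columns, an endomorphism field J has J e_j = \sum_i J_ij e_i,
   and a bilinear form B has B_ij = B(e_i, e_j). *)
Definition frame_der (i : 'I_4) (f : sol4_quotient -> R) : sol4_quotient -> R :=
  fun m => 'D_(frame i (repr m)) (f \o sol4_proj) (repr m).

Lemma sol4_projK (m : sol4_quotient) : sol4_proj (repr m) = m.
Proof. exact: reprK. Qed.

Lemma sol4_proj_eq p q :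
  sol4_proj p = sol4_proj q <->
  exists2 a, dsubgroup_set Gamma a & q = sol4_mul a p.
Proof.
split=> [/eqmodP/asboolP//|H]; apply/eqmodP; exact/asboolP.
Qed.

Lemma frame_derE i f p :
  frame_der i f (sol4_proj p) = 'D_(frame i p) (f \o sol4_proj) p.
Proof.
rewrite /frame_der.
have /sol4_proj_eq[a Ga ->] : sol4_proj p = sol4_proj (repr (sol4_proj p))
  by rewrite sol4_projK.
rewrite frame_invariant derive_sol4_mul /derive; congr (lim (_ @ 0^')).
apply/funext => h /=; congr (_ *: (f _ - f _));
  apply/esym/sol4_proj_eq; last by exists a.
by exists a => //; rewrite addrC -sol4_mul_affine [p + _]addrC.
Qed.


End Quotient.

Section Geometry.
Context {R : realType} {Gamma : discrete_subgroup R}.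
Local Notation M := (sol4_quotient Gamma).
Implicit Types (f u : M -> R) (U : set M) (V W Z : M -> 'cV[R]_4).
Implicit Types (J g : M -> 'M[R]_4).

Fixpoint continuously_derivable (k : nat) (O : set 'rV[R]_4)
    (F : 'rV[R]_4 -> R) : Prop :=
  {in O, forall p, {for p, continuous F}} /\
  if k is k'.+1 then forall i : 'I_4,
    {in O, forall p, derivable F p (delta_mx 0 i)} /\
    continuously_derivable k' O ('D_(delta_mx 0 i) F)
  else True.

(* The smooth structure of the quotient is the one for which the projection
   from R^4 is a local diffeomorphism.  Functions are total, so values outside
   the open set U are irrelevant. *)
Definition smooth_on U f : Prop :=
  forall k,
    continuously_derivable k (sol4_proj Gamma @^-1` U) (f \o sol4_proj Gamma).

Definition smooth_mx_on m n U (A : M -> 'M[R]_(m, n)) : Prop :=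
  forall i j, smooth_on U (fun x => A x i j).

Definition vf_der V f : M -> R := fun x => \sum_i V x i 0 * frame_der i f x.

(* [V,W] for V = \sum_i V^i e_i and W = \sum_j W^j e_j *)
Definition bracket V W : M -> 'cV[R]_4 := fun x => \col_k
  (vf_der V (fun y => W y k 0) x - vf_der W (fun y => V y k 0) x
   + \sum_i \sum_j V x i 0 * W x j 0 * sol4_cst i j k).

Definition endo J V : M -> 'cV[R]_4 := fun x => J x *m V x.

Definition nijenhuis J V W : M -> 'cV[R]_4 := fun x =>
  bracket (endo J V) (endo J W) x - endo J (bracket (endo J V) W) x
  - endo J (bracket V (endo J W)) x + endo J (endo J (bracket V W)) x.

Definition integrable_endo U J : Prop :=
  forall V W, smooth_mx_on U V -> smooth_mx_on U W ->
  {in U, forall x, nijenhuis J V W x = 0}.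

Definition hyper_paracomplex U J1 J2 J3 : Prop :=
  [/\ smooth_mx_on U J1, smooth_mx_on U J2 & smooth_mx_on U J3] /\
  {in U, forall x,
    [/\ J1 x *m J1 x = 1%:M, J2 x *m J2 x = 1%:M, J3 x *m J3 x = - 1%:M,
        J1 x *m J2 x = J3 x & J2 x *m J1 x = - J3 x]} /\
  [/\ integrable_endo U J1, integrable_endo U J2 & integrable_endo U J3].

Definition pseudo_Riemannian U g : Prop :=
  smooth_mx_on U g /\
  {in U, forall x, (g x)^T = g x /\ g x \in unitmx}.

Definition compatible U J1 J2 J3 g : Prop := {in U, forall x,
  [/\ (J1 x)^T *m g x *m J1 x = - g x, (J2 x)^T *m g x *m J2 x = - g x
    & (J3 x)^T *m g x *m J3 x = g x]}.

Definition hyper_paraHermitian U J1 J2 J3 g : Prop :=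
  [/\ hyper_paracomplex U J1 J2 J3, pseudo_Riemannian U g
    & compatible U J1 J2 J3 g].

(* Koszul's formula: [koszul g i j l] is g(nabla_{e_i} e_j, e_l), and
   nabla_{e_i} e_j = \sum_k christoffel g i j k e_k. *)
Definition koszul g (i j l : 'I_4) : M -> R := fun x => 2^-1 *
  (frame_der i (fun y => g y j l) x + frame_der j (fun y => g y i l) x
   - frame_der l (fun y => g y i j) x
   + \sum_k sol4_cst i j k * g x k l
   - \sum_k sol4_cst i l k * g x k j
   - \sum_k sol4_cst j l k * g x k i).

Definition christoffel g (i j k : 'I_4) : M -> R :=
  fun x => \sum_l koszul g i j l x * invmx (g x) l k.

Definition levi_civita g V W : M -> 'cV[R]_4 := fun x => \col_k
  (vf_der V (fun y => W y k 0) x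
   + \sum_i \sum_j V x i 0 * W x j 0 * christoffel g i j k x).

Definition parallel U g J : Prop :=
  forall V W, smooth_mx_on U V -> smooth_mx_on U W ->
  {in U, forall x,
    levi_civita g V (endo J W) x = endo J (levi_civita g V W) x}.

Definition hyper_paraKahler U J1 J2 J3 g : Prop :=
  hyper_paraHermitian U J1 J2 J3 g /\
  [/\ parallel U g J1, parallel U g J2 & parallel U g J3].

Definition conformal_change u g : M -> 'M[R]_4 := fun x => expR (u x) *: g x.

Definition globally_conformally_hyper_paraKahler J1 J2 J3 g : Prop :=
  exists2 u, smooth_on setT u &
    hyper_paraKahler setT J1 J2 J3 (conformal_change u g).

Definition locally_conformally_hyper_paraKahler J1 J2 J3 g : Prop :=
  forall x : M, exists U, [/\ open U, U x & exists2 u, smooth_on U u &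
    hyper_paraKahler U J1 J2 J3 (conformal_change u g)].

Definition curvature g V W Z : M -> 'cV[R]_4 := fun x =>
  levi_civita g V (levi_civita g W Z) x - levi_civita g W (levi_civita g V Z) x
  - levi_civita g (bracket V W) Z x.

Definition frame_field (i : 'I_4) : M -> 'cV[R]_4 := fun=> delta_mx i 0.

(* [riemann g i j k l] is g(R(e_i,e_j)e_k, e_l), with
   R(V,W)Z = nabla_V nabla_W Z - nabla_W nabla_V Z - nabla_[V,W] Z; the signs in
   [ricci] and [weyl] are the ones of this convention. *)
Definition riemann g (i j k l : 'I_4) : M -> R := fun x =>
  \sum_m curvature g (frame_field i) (frame_field j) (frame_field k) x m 0
         * g x m l.

Definition ricci g (j k : 'I_4) : M -> R := fun x =>
  \sum_i curvature g (frame_field i) (frame_field j) (frame_field k) x i 0.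

Definition scalar_curvature g : M -> R := fun x =>
  \sum_j \sum_k invmx (g x) j k * ricci g j k x.

Definition weyl g (i j k l : 'I_4) : M -> R := fun x =>
  riemann g i j k l x
  - 2^-1 * (g x i l * ricci g j k x - g x i k * ricci g j l x
            + g x j k * ricci g i l x - g x j l * ricci g i k x)
  + scalar_curvature g x / 6 * (g x i l * g x j k - g x i k * g x j l).

Definition weyl_flat g : Prop := forall i j k l x, weyl g i j k l x = 0.

Definition levi_civita_symbol (i j k l : 'I_4) : R :=
  \det (\matrix_(a < 4, b < 4) (tnth [tuple i; j; k; l] a == b)%:R).

(* Hodge star on 2-forms (antisymmetric matrices) for the metric h and the
   orientation in which (X,Y,Z,W) is positive ([b = false]) or negative
   ([b = true]). *)
Definition hodge (b : bool) (h F : 'M[R]_4) : 'M[R]_4 := \matrix_(i, j)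
  (2^-1 * \sum_k \sum_l (-1) ^+ b * Num.sqrt `|\det h|
     * levi_civita_symbol i j k l * (invmx h *m F *m (invmx h)^T) k l).

Definition self_dual b h F : Prop := hodge b h F = F.

Definition fundamental_form J g : M -> 'M[R]_4 := fun x => g x *m J x.

(* W^+ = (W + *W) / 2, the star acting on the first pair of indices. *)
Definition weyl_plus b g (i j k l : 'I_4) : M -> R := fun x => 2^-1 *
  (weyl g i j k l x
   + hodge b (g x) (\matrix_(p, q) weyl g p q k l x) i j).

Definition anti_self_dual J1 J2 J3 g : Prop := exists b : bool,
  (forall x, [/\ self_dual b (g x) (fundamental_form J1 g x),
                 self_dual b (g x) (fundamental_form J2 g x)
               & self_dual b (g x) (fundamental_form J3 g x)]) /\
  (forall i j k l x, weyl_plus b g i j k l x = 0).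

Lemma christoffel_lower g i j l x : g x \in unitmx ->
  \sum_k christoffel g i j k x * g x k l = koszul g i j l x.
Proof.
move=> gu; pose K := \row_l koszul g i j l x.
have /rowP/(_ l) : K *m invmx (g x) *m g x = K by rewrite mulmxKV.
rewrite [RHS]mxE [LHS]mxE => <-; apply: eq_bigr => k _; congr (_ * _).
by rewrite mxE; apply: eq_bigr => m _; rewrite mxE.
Qed.

Lemma levi_civita_torsion_free g i j k x :
  (forall y, (g y)^T = g y) -> g x \in unitmx ->
  christoffel g i j k x - christoffel g j i k x = sol4_cst i j k.
Proof.
move=> gs gu.
have gC y a b : g y a b = g y b a by rewrite -{1}gs mxE.
have gC' a b : (fun y => g y a b) = fun y => g y b a by apply/funext.
have koszulB l :
    koszul g i j l x - koszul g j i l x = \sum_m sol4_cst i j m * g x m l.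
  have E : \sum_m sol4_cst j i m * g x m l = - \sum_m sol4_cst i j m * g x m l.
    by rewrite -sumrN; apply: eq_bigr => m _; rewrite sol4_cst_skew mulNr.
  by rewrite /koszul (gC' j i) E; field.
rewrite /christoffel -sumrB; under eq_bigr do rewrite -mulrBl koszulB.
pose K := \row_m (sol4_cst i j m : R).
have /rowP/(_ k) : K *m g x *m invmx (g x) = K by rewrite mulmxK.
rewrite [RHS]mxE [LHS]mxE => <-; apply: eq_bigr => l _; congr (_ * _).
by rewrite mxE; apply: eq_bigr => m _; rewrite mxE.
Qed.

Lemma levi_civita_metric g i j l x :
  (forall y, (g y)^T = g y) -> g x \in unitmx ->
  frame_der i (fun y => g y j l) x =
    \sum_k christoffel g i j k x * g x k l +
    \sum_k christoffel g i l k x * g x j k.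
Proof.
move=> gs gu.
have gC y a b : g y a b = g y b a by rewrite -{1}gs mxE.
have gC' a b : (fun y => g y a b) = fun y => g y b a by apply/funext.
rewrite christoffel_lower//.
rewrite [X in _ = _ + X](_ : _ = koszul g i l j x); last first.
  by rewrite -christoffel_lower//; apply: eq_bigr => k _; rewrite (gC _ j).
have E : \sum_m sol4_cst l j m * g x m i = - \sum_m sol4_cst j l m * g x m i.
  by rewrite -sumrN; apply: eq_bigr => m _; rewrite sol4_cst_skew mulNr.
by rewrite /koszul (gC' l j) E; field.
Qed.

End Geometry.

(* Main.v *)
(* Let x, y, z, w be the left-invariant coframe dual to X, Y, Z, W, so that
   dx = w^x, dy = y^w, dz = y^x and dw = 0.  The invariant 2-forms
     F1 = x^y - z^w,   F2 = x^z + (x+y)^w,   F3 = x^z - (x+y)^w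
   satisfy dF = w^F and F1^2 = F2^2 = - F3^2, with vanishing mixed products, so
   they are the fundamental forms of an invariant hyper-paraHermitian structure,
   which descends to every quotient; e^{-w} F1, e^{-w} F2, e^{-w} F3 are closed,
   hence e^{-w} g is hypersymplectic, but the coordinate w exists only locally
   on the quotient.  The Weyl tensor of g is 2 (x^w)(x^w), where x^w is
   anti-self-dual; it is the summand x^w of F2 and F3 that makes it nonzero.
   If e^u g were hypersymplectic on a compact quotient then, at a maximum of u,
   the connection of e^u g is the one of g, for which J1 is not parallel. *)
Require Import Defs.
From mathcomp Require Import all_boot all_order all_algebra.
From mathcomp Require Import all_classical all_reals all_analysis.
From mathcomp Require Import ring lra.

Set Implicit Arguments.
Unset Strict Implicit.
Unset Printing Implicit Defensive.

Import Order.TTheory GRing.Theory Num.Theory.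
Import numFieldNormedType.Exports.

Local Open Scope classical_set_scope.
Local Open Scope ring_scope.

(** * Directional derivatives along combinations of two vectors *)

Section DirectionalDerivatives.
Context {R : realType} {V : normedModType R}.
Implicit Types (f : V -> R) (p v w : V).

(** The two difference quotients are the same function of the increment. This reduces directional
    derivatives to calculus in one variable. *)
Lemma is_derive_lineP f p v (t l : R) :
  is_derive t (1 : R) (fun h => f (h *: v + p)) l <->
  is_derive (t *: v + p) v f l.
Proof.
have E : (fun h : R => h^-1 *: (((fun h => f (h *: v + p)) \o shift t) (h *: 1)
      - f (t *: v + p))) =
    fun h => h^-1 *: ((f \o shift (t *: v + p)) (h *: v) - f (t *: v + p)).
  apply/funext => h /=; congr (_ *: (f _ - _)).
  by rewrite [h *: 1]mulr1 scalerDl addrA.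
by split=> -[d1 d2]; split; move: d1 d2; rewrite /derivable /derive E.
Qed.

(** The bound by [|x|] replaces the interval of the mean value theorem, so that later increments
    need no discussion of signs. *)
Lemma MVT_two_sided (f df : R -> R) (x : R) :
  (forall t, `|t| <= `|x| -> is_derive t (1 : R) f (df t)) ->
  exists2 c, `|c| <= `|x| & f x - f 0 = df c * x.
Proof.
move=> fdf.
have cont a b : (forall t, t \in `[a, b] -> `|t| <= `|x|) ->
    {within `[a, b], continuous f}.
  by move=> ab; apply: derivable_within_continuous => t /ab /fdf[].
have [x0|x0] := leP 0 x.
  have itv t : t \in `[0, x] -> `|t| <= `|x|.
    by rewrite in_itv/= => /andP[t0 tx]; rewrite !ger0_norm.
  have d t (tx : t \in _) := fdf t (itv t (subset_itv_oo_cc tx)).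
  have [c cx ->] := MVT_segment x0 d (cont _ _ itv).
  by exists c; [exact: itv|rewrite subr0].
have itv t : t \in `[x, 0] -> `|t| <= `|x|.
  by rewrite in_itv/= => /andP[tx t0]; rewrite !ler0_norm ?lerN2// ltW.
have d t (tx : t \in _) := fdf t (itv t (subset_itv_oo_cc tx)).
have [c cx E] := MVT_segment (ltW x0) d (cont _ _ itv).
by exists c; [exact: itv|rewrite -opprB E sub0r mulrN opprK].
Qed.

(* The increment along [a *: v + b *: w] is split into one along v and one along
   w; the mean value theorem evaluates the latter at a point close to p. *)
Lemma is_derive_comb2 f p v w (a b : R) :
  derivable f p v -> (\forall q \near p, derivable f q w) ->
  {for p, continuous ('D_w f)} ->
  is_derive p (a *: v + b *: w) f (a * 'D_v f p + b * 'D_w f p).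
Proof.
move=> fv fw cfw; rewrite -[X in is_derive X](add0r p).
rewrite -(scale0r (a *: v + b *: w)); apply/is_derive_lineP.
pose f1 h := f ((a * h) *: v + p).
pose f2 h := f (h *: (a *: v + b *: w) + p) - f1 h.
rewrite (_ : (fun h => _) = f1 + f2); last first.
  by apply/funext => h; rewrite /f2 /= fctE addrC subrK.
apply: is_deriveD.
  have -> : f1 = (fun h => f (h *: v + p)) \o ( *%R a) by [].
  have d1 : is_derive (0 : R) (1 : R) ( *%R a) a.
    rewrite -[X in is_derive _ _ _ X](mulr1 a).
    exact: (is_deriveZ a (is_derive_id (0 : R) (1 : R))).
  have d2 : is_derive (a * 0) (1 : R) (fun h => f (h *: v + p)) ('D_v f p).
    apply/is_derive_lineP; rewrite mulr0 scale0r add0r.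
    exact: derivableP.
  by have := is_derive1_comp d2 d1; rewrite mulrC.
have f20 : f2 0 = 0 by rewrite /f2 /f1 mulr0 !scale0r subrr.
suff L : h^-1 *: (f2 h) @[h --> (0 : R)^'] --> b * 'D_w f p.
  have E : (fun h : R => h^-1 *: ((f2 \o shift 0) (h *: 1) - f2 0)) =
      fun h => h^-1 *: f2 h.
    by apply/funext => h /=; rewrite addr0 f20 subr0 [h *: 1]mulr1.
  split; rewrite /derivable /derive E; first by apply/cvg_ex; eexists; exact: L.
  exact/cvg_lim.
apply/cvgrPdist_lt => e e0.
(* Adding 1 keeps the denominator positive when b = 0. *)
have e'0 : 0 < e / (`|b| + 1) by rewrite divr_gt0// ltr_wpDl.
have near_p : \forall q \near p, derivable f q w /\
    `|'D_w f p - 'D_w f q| < e / (`|b| + 1).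
  apply: filterI; first exact: fw.
  by move/cvgrPdist_lt : cfw; apply.
have : \forall st \near ((0 : R), (0 : R)),
    let q := st.2 *: w + (st.1 *: v + p) in
    derivable f q w /\ `|'D_w f p - 'D_w f q| < e / (`|b| + 1).
  have : (st.2 *: w + (st.1 *: v + p)) @[st --> ((0 : R), (0 : R))] --> p.
    rewrite -[X in _ --> X]add0r -[X in _ --> 0 + X]add0r.
    rewrite -{1}(scale0r w) -(scale0r v).
    apply: cvgD; first by apply: cvgZr_tmp; exact: cvg_snd.
    by apply: cvgD; [apply: cvgZr_tmp; exact: cvg_fst|exact: cvg_cst].
  by move/(_ _ near_p).
have lin0 (c d : R) : 0 < d -> \forall h \near (0 : R)^', `|c * h| < d.
  have : c * h @[h --> (0 : R)] --> c * 0 by apply: cvgMr; exact: cvg_id.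
  by rewrite mulr0 => /cvg_within_filter/cvgr0_norm_lt; apply.
move=> [[A B]/= [[dA/= dA0 AP] [dB/= dB0 BP]] ABP].
near=> h.
have h0 : h != 0 by near: h; exact: nbhs_dnbhs_neq.
have hA : `|a * h| < dA by near: h; exact: lin0.
have hB : `|b * h| < dB by near: h; exact: lin0.
have good t : `|t| <= `|b * h| -> derivable f (t *: w + ((a * h) *: v + p)) w /\
    `|'D_w f p - 'D_w f (t *: w + ((a * h) *: v + p))| < e / (`|b| + 1).
  move=> th; apply: (ABP (_, _)); split => /=.
    by apply: AP; rewrite /= sub0r normrN.
  by apply: BP; rewrite /= sub0r normrN; exact: le_lt_trans hB.
have [t|c cbh E] := @MVT_two_sided (fun t => f (t *: w + ((a * h) *: v + p)))
    (fun t => 'D_w f (t *: w + ((a * h) *: v + p))) (b * h).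
  by move=> /good[d _]; apply/is_derive_lineP; exact: derivableP.
have -> : f2 h = 'D_w f (c *: w + ((a * h) *: v + p)) * (b * h).
  rewrite -E scale0r add0r /f2 /f1; congr (f _ - _).
  by rewrite addrA scalerDr !scalerA ![h * _]mulrC [X in X + p = _]addrC.
rewrite (_ : h^-1 *: _ = b * 'D_w f (c *: w + ((a * h) *: v + p))); last first.
  by rewrite /GRing.scale/=; field.
rewrite -mulrBr normrM.
have [_ lt_e] := good _ cbh.
apply: (le_lt_trans (ler_wpM2r (normr_ge0 _) (ler_wpDr ler01 (lexx `|b|)))).
by rewrite mulrC -ltr_pdivlMr// ltr_wpDl.
Unshelve. all: by end_near.
Qed.
End DirectionalDerivatives.

(** * Smooth functions on the quotient and derivatives along the frame *)

Section SmoothFunctions.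
Context {R : realType} {Gamma : discrete_subgroup R}.
Local Notation M := (sol4_quotient Gamma).
Local Notation proj := (sol4_proj Gamma).
Implicit Types (f u : M -> R) (U : set M) (V W : M -> 'cV[R]_4) (x : M).

Lemma sol4_proj_continuous : continuous proj.
Proof. exact: pi_continuous. Qed.

Lemma open_preimage_proj U : open U -> open (proj @^-1` U).
Proof.
by move=> oU; apply: open_comp => // p _; exact: sol4_proj_continuous.
Qed.

(** Only Y has a second component, along d/dz. Two summands are thus enough, which is the case
    treated by [is_derive_comb2]. *)
Lemma frame_coordinate (i : 'I_4) (p : 'rV[R]_4) : exists a b : R,
  frame i p = a *: delta_mx 0 i + b *: delta_mx 0 2.
Proof.
have [f0 f1 f2 f3] := frame_expr p.
case: i => -[|[|[|[|//]]]] hi.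
- exists (expR (- p 0 3)), 0.
  rewrite (_ : Ordinal hi = 0) ?f0; last exact: val_inj.
  by apply: row4P; rewrite !(row4E, mxE) /=; split; ring.
- exists (expR (p 0 3)), (expR (p 0 3) * p 0 0).
  rewrite (_ : Ordinal hi = 1) ?f1; last exact: val_inj.
  by apply: row4P; rewrite !(row4E, mxE) /=; split; ring.
- exists 1, 0; rewrite (_ : Ordinal hi = 2) ?f2; last exact: val_inj.
  by apply: row4P; rewrite !(row4E, mxE) /=; split; ring.
- exists 1, 0; rewrite (_ : Ordinal hi = 3) ?f3; last exact: val_inj.
  by apply: row4P; rewrite !(row4E, mxE) /=; split; ring.
Qed.

(** Smoothness is phrased with coordinate partial derivatives only; continuity of the one along z
    gives derivability along the frame. *)
Lemma smooth_on_derivable_frame U f (i : 'I_4) x :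
  open U -> U x -> smooth_on U f ->
  derivable (f \o proj) (repr x) (frame i (repr x)).
Proof.
move=> oU Ux sf; have [_ Df] := sf 1%N.
have Ox : (proj @^-1` U) (repr x) by rewrite /= sol4_projK.
have [a [b ->]] := frame_coordinate i (repr x).
apply: ex_derive; apply: is_derive_comb2.
- by have [+ _] := Df i; apply; rewrite inE.
- have [D2 _] := Df 2; have oO := open_preimage_proj oU.
  apply: filterS (open_nbhs_nbhs (conj oO Ox)) => q Oq.
  by apply: D2; rewrite inE.
- by have [_ [+ _]] := Df 2; apply; rewrite inE.
Qed.

Lemma frame_der_cst (i : 'I_4) (c : R) x : frame_der i (fun=> c) x = 0.
Proof. exact: derive_cst. Qed.

Lemma frame_der_lincomb U (f : 'I_4 -> M -> R) (c : 'I_4 -> R) (i : 'I_4) x :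
  open U -> U x -> (forall j, smooth_on U (f j)) ->
  frame_der i (fun y => \sum_j c j * f j y) x =
  \sum_j c j * frame_der i (f j) x.
Proof.
move=> oU Ux sf.
have D j := is_deriveZ (c j)
  (derivableP (@smooth_on_derivable_frame U (f j) i x oU Ux (sf j))).
have [_ <-] := is_derive_sum D; rewrite /frame_der; congr ('D__ _ _).
by apply/funext => q; rewrite fct_sumE.
Qed.

(** This is the flat connection for which the frame is parallel. Brackets and Levi-Civita
    derivatives differ from it by algebraic terms. *)
Definition frame_jacobian V W x : 'cV[R]_4 :=
  \col_k vf_der V (fun y => W y k 0) x.

Lemma frame_jacobian_endo U (A : 'M[R]_4) V W x :
  open U -> U x -> smooth_mx_on U W ->
  frame_jacobian V (endo (fun=> A) W) x = A *m frame_jacobian V W x.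
Proof.
move=> oU Ux sW; apply/colP => k; rewrite !mxE.
under [RHS]eq_bigr do rewrite mxE mulr_sumr; rewrite exchange_big/=.
apply: eq_bigr => i _.
rewrite (_ : (fun y => _) = fun y => \sum_j A k j * W y j 0); last first.
  by apply/funext => y; rewrite mxE.
rewrite (frame_der_lincomb _ _ oU Ux) => [|j]; last exact: sW.
by rewrite mulr_sumr; apply: eq_bigr => j _; rewrite mulrCA.
Qed.

Definition sol4_lie (v w : 'cV[R]_4) : 'cV[R]_4 :=
  \col_k \sum_i \sum_j v i 0 * w j 0 * sol4_cst i j k.

Lemma bracket_jacobian V W x :
  bracket V W x =
  frame_jacobian V W x - frame_jacobian W V x + sol4_lie (V x) (W x).
Proof. by apply/colP => k; rewrite !mxE. Qed.

(** A constant A commutes with [frame_jacobian], so all derivative terms of the Nijenhuis tensor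
    cancel and only its Lie algebra version remains. *)
Lemma integrable_endo_cst U (A : 'M[R]_4) : open U ->
  (forall v w, sol4_lie (A *m v) (A *m w) - A *m sol4_lie (A *m v) w
     - A *m sol4_lie v (A *m w) + A *m (A *m sol4_lie v w) = 0) ->
  integrable_endo U (fun=> A).
Proof.
move=> oU N0 V W sV sW x; rewrite inE => Ux.
rewrite -[RHS](N0 (V x) (W x)) /nijenhuis /endo !bracket_jacobian.
rewrite !(@frame_jacobian_endo U A _ _ x oU Ux)//.
rewrite !(mulmxDr, mulmxN).
move: (A *m frame_jacobian (fun=> _) W x) (A *m frame_jacobian (fun=> _) V x).
move: (A *m (A *m frame_jacobian V W x)) (A *m (A *m frame_jacobian W V x)).
move=> a b c d; apply/colP => k; rewrite !mxE; ring.
Qed.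
End SmoothFunctions.

(** * Smoothness of functions locally affine in w and exp(-w) *)

Section ExponentialAffine.
Context {R : realType}.
Implicit Types (F : 'rV[R]_4 -> R) (O : set 'rV[R]_4) (p q v : 'rV[R]_4).

(* A class of functions of the fourth coordinate w that contains w, [expR (- w)]
   and the constants, and is stable under d/dw. *)
Definition exp_affine (a b c : R) (q : 'rV[R]_4) : R :=
  a * q 0 3 + b + c * expR (- q 0 3).

Lemma is_derive_exp_affine a b c p v :
  is_derive p v (exp_affine a b c) ((a - c * expR (- p 0 3)) * v 0 3).
Proof.
rewrite -[X in is_derive X](add0r p) -(scale0r v).
apply/is_derive_lineP; rewrite /exp_affine; under eq_fun do rewrite !mxE.
apply: is_derive_eq; rewrite !scaler0 !addr0 !add0r !scaler1 mul0r add0r.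
by rewrite /GRing.scale/=; ring.
Qed.

Lemma continuous_exp_affine a b c : continuous (exp_affine a b c).
Proof.
suff H p : exp_affine a b c q @[q --> p] --> exp_affine a b c p by exact: H.
have cw : (q : 'rV[R]_4) 0 3 @[q --> p] --> p 0 3 by exact: coord_continuous.
have cE : expR (- (q : 'rV[R]_4) 0 3) @[q --> p] --> expR (- p 0 3).
  exact: (cvg_comp _ _ (cvgN cw) (@continuous_expR R (- p 0 3))).
exact: (cvgD (cvgD (cvgM (cvg_cst a) cw) (cvg_cst b)) (cvgM (cvg_cst c) cE)).
Qed.

(** The coefficients may vary with the point: on the preimage of a small open set of the quotient,
    the local coordinate agrees with w up to a constant that depends on the sheet. *)
Definition locally_exp_affine O F :=
  forall p, O p -> exists a b c, {near p, F =1 exp_affine a b c}.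

Lemma locally_exp_affineM O F r :
  locally_exp_affine O F -> locally_exp_affine O (fun q => F q * r).
Proof.
move=> OF p /OF[a [b [c E]]]; exists (a * r), (b * r), (c * r).
by apply: filterS E => q ->; rewrite /exp_affine; ring.
Qed.

Lemma locally_exp_affine_smooth O F : open O -> locally_exp_affine O F ->
  forall k, continuously_derivable k O F.
Proof.
move=> oO OF k.
have cF G : locally_exp_affine O G ->
    {in O, forall p, {for p, continuous G}}.
  move=> OG p; rewrite inE => /OG[a [b [c E]]].
  rewrite /prop_for /continuous_at (nbhs_singleton E).
  have E' : {near p, exp_affine a b c =1 G} by apply: filterS E => q /esym.
  exact: cvg_trans (near_eq_cvg E') (@continuous_exp_affine a b c p).
elim: k F OF => [|k IH] F OF; split; [exact: cF|by []|exact: cF|move=> i].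
split=> [p|].
  rewrite inE => /OF[a [b [c E]]].
  have E' : {near p, exp_affine a b c =1 F} by apply: filterS E => q /esym.
  have [D _] := is_derive_exp_affine a b c p (delta_mx 0 i).
  exact: near_eq_derivable E' D.
apply: IH => p /OF[a [b [c E]]].
pose d : R := (delta_mx 0 i : 'rV[R]_4) 0 3.
(* The partial derivative is (a - c exp(-w)) d, with d = 1 in the direction w and d = 0 in the
   others. *)
exists 0, (a * d), (- c * d).
(* Differentiating at q needs equality in a whole neighborhood of q; passing to the interior
   provides it for all q near p. *)
apply: filterS (nbhs_interior E) => q qE.
have [_ D] := is_derive_exp_affine a b c q (delta_mx 0 i).
rewrite (near_eq_derive _ qE) D.
by rewrite /exp_affine -/d; ring.
Qed.
End ExponentialAffine.

(** * Tensors with constant components in the frame *)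

Section ConstantTensors.
Context {R : realType} {Gamma : discrete_subgroup R}.
Local Notation M := (sol4_quotient Gamma).
Local Notation proj := (sol4_proj Gamma).
Implicit Types (f u : M -> R) (U : set M) (V W : M -> 'cV[R]_4) (x : M).
Implicit Types (g : M -> 'M[R]_4) (A : 'M[R]_4).

Definition connection g x (v w : 'cV[R]_4) : 'cV[R]_4 :=
  \col_k \sum_i \sum_j v i 0 * w j 0 * christoffel g i j k x.

Lemma levi_civita_jacobian g V W x :
  levi_civita g V W x = frame_jacobian V W x + connection g x (V x) (W x).
Proof. by apply/colP => k; rewrite !mxE. Qed.

Lemma frame_jacobian_cst V (w : 'cV[R]_4) x : frame_jacobian V (fun=> w) x = 0.
Proof.
apply/colP => k; rewrite !mxE /vf_der big1// => i _.
by rewrite frame_der_cst mulr0.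
Qed.

Lemma levi_civita_cst g V (w : 'cV[R]_4) x :
  levi_civita g V (fun=> w) x = connection g x (V x) w.
Proof. by rewrite levi_civita_jacobian frame_jacobian_cst add0r. Qed.

Lemma bracket_cst (v w : 'cV[R]_4) :
  bracket (fun=> v) (fun=> w) = (fun=> sol4_lie v w) :> (M -> _).
Proof.
by apply/funext => x; rewrite bracket_jacobian !frame_jacobian_cst subr0 add0r.
Qed.

Lemma smooth_on_locally_exp_affine U f : open U ->
  locally_exp_affine (proj @^-1` U) (f \o proj) -> smooth_on U f.
Proof.
move=> oU Uf k; apply: locally_exp_affine_smooth => //.
Qed.

Lemma smooth_on_cst U (c : R) : open U -> smooth_on U (fun=> c).
Proof.
move=> oU; apply: smooth_on_locally_exp_affine => // p _; exists 0, c, 0.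
by apply: (@nearW _ (nbhs p)) => q; rewrite /exp_affine /=; ring.
Qed.

Lemma smooth_mx_on_cst U m n (A : 'M[R]_(m, n)) :
  open U -> smooth_mx_on U (fun=> A).
Proof. by move=> oU i j; exact: smooth_on_cst. Qed.

(** Constant fields serve as test fields in one direction; in the other, the derivative terms
    commute with A. *)
Lemma parallel_cstP U g A : open U ->
  parallel U g (fun=> A) <->
  forall x, U x ->
    forall v w, connection g x v (A *m w) = A *m connection g x v w.
Proof.
move=> oU; split=> [pA x Ux v w|gA V W sV sW x].
  have sc (z : 'cV[R]_4) := smooth_mx_on_cst z oU.
  have := pA (fun=> v) (fun=> w) (sc v) (sc w) x (mem_set Ux).
  by rewrite /endo (levi_civita_cst g _ (A *m w)) levi_civita_cst.
rewrite inE => Ux; rewrite [endo _ (levi_civita _ _ _) _]/endo.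
rewrite !levi_civita_jacobian (@frame_jacobian_endo _ _ U A _ _ x oU Ux)//.
by rewrite mulmxDr gA.
Qed.

(* For [phi = 1] this is the connection of a constant metric and for
   [phi = expR u] the one of a conformal change of it. *)
Lemma koszul_conformal_cst (phi : M -> R) (h : 'M[R]_4) (i j l : 'I_4) x :
  (forall i, derivable (phi \o proj) (repr x) (frame i (repr x))) ->
  koszul (fun y => phi y *: h) i j l x = 2^-1 *
  (frame_der i phi x * h j l + frame_der j phi x * h i l
   - frame_der l phi x * h i j
   + phi x * (\sum_k sol4_cst i j k * h k l - \sum_k sol4_cst i l k * h k j
              - \sum_k sol4_cst j l k * h k i)).
Proof.
move=> dphi.
have D k a b :
    frame_der k (fun y => (phi y *: h) a b) x = frame_der k phi x * h a b.
  rewrite /frame_der (_ : _ \o _ = h a b \*: (phi \o proj)).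
    by rewrite deriveZ// mulrC.
  by apply/funext => q; rewrite /= mxE mulrC.
have S a b c : \sum_k sol4_cst a b k * (phi x *: h) k c =
    phi x * \sum_k sol4_cst a b k * h k c.
  by rewrite mulr_sumr; apply: eq_bigr => k _; rewrite mxE mulrCA.
rewrite /koszul (D i j l) (D j i l) (D l i j) (S i j l) (S i l j) (S j l i).
move: (frame_der i phi x) (frame_der j phi x) (frame_der l phi x) => a b c.
by move: (bigop _ _ _) (bigop _ _ _) (bigop _ _ _) => u v w; ring.
Qed.
End ConstantTensors.

Lemma ord4_ind (P : 'I_4 -> Prop) : P 0 -> P 1 -> P 2 -> P 3 -> forall i, P i.
Proof.
move=> P0 P1 P2 P3 [[|[|[|[|//]]]] hi].
- by rewrite (_ : Ordinal hi = 0); last exact: val_inj.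
- by rewrite (_ : Ordinal hi = 1); last exact: val_inj.
- by rewrite (_ : Ordinal hi = 2); last exact: val_inj.
- by rewrite (_ : Ordinal hi = 3); last exact: val_inj.
Qed.

(** * The invariant structure on the Lie algebra, its connection and curvature *)

Section LieAlgebra.
Context {R : realType}.
Implicit Types (u v w z : 'cV[R]_4) (i j k l : 'I_4) (t : R).

Definition mx4 (s : seq (seq R)) : 'M[R]_4 := \matrix_(i, j) (nth [::] s i)`_j.

Definition col4 (a b c d : R) : 'cV[R]_4 := \col_k [:: a; b; c; d]`_k.

Lemma col4E (a b c d : R) : (col4 a b c d 0 0 = a) * (col4 a b c d 1 0 = b) *
  (col4 a b c d 2 0 = c) * (col4 a b c d 3 0 = d).
Proof. by rewrite !mxE. Qed.

Lemma colP4 u v : u 0 0 = v 0 0 -> u 1 0 = v 1 0 -> u 2 0 = v 2 0 ->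
  u 3 0 = v 3 0 -> u = v.
Proof. by move=> *; apply/colP; elim/ord4_ind. Qed.

(** Matrix identities are checked on a generic vector: [mulmx4E] then evaluates products one factor
    at a time, leaving polynomial identities. *)
Lemma eq_mulmx_col (A B : 'M[R]_4) : (forall v, A *m v = B *m v) -> A = B.
Proof.
move=> AB; apply/matrixP => i j.
by have /colP/(_ i) := AB (delta_mx j 0); rewrite -!colE !mxE.
Qed.

(** The three endomorphisms are [metric_inv] times the matrices of F1, F2, F3, as [para_form]
    confirms. The first has eigenvectors Y, W for 1 and X - Y, Z for -1. *)
Definition para1 := mx4 [:: [:: -1; 0; 0; 0];
                            [:: 2; 1; 0; 0];
                            [:: 0; 0; -1; 0];
                            [:: 0; 0; 0; 1]].

Definition para2 := mx4 [:: [:: 0; 0; 0; 1];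
                            [:: 0; 0; 1; -1];
                            [:: 1; 1; 0; 0];
                            [:: 1; 0; 0; 0]].

Definition para3 := mx4 [:: [:: 0; 0; 0; -1];
                            [:: 0; 0; 1; 1];
                            [:: -1; -1; 0; 0];
                            [:: 1; 0; 0; 0]].

(** The quadratic form is 2 x^2 + 2 xy - 2 zw. The term 2 x^2 comes from the summand x^w of F2 and
    F3. *)
Definition metric := mx4 [:: [:: 2; 1; 0; 0];
                             [:: 1; 0; 0; 0];
                             [:: 0; 0; 0; -1];
                             [:: 0; 0; -1; 0]].

Definition metric_inv := mx4 [:: [:: 0; 1; 0; 0];
                                 [:: 1; -2; 0; 0];
                                 [:: 0; 0; 0; -1];
                                 [:: 0; 0; -1; 0]].

Lemma mulmx4E v :
  ((para1 *m v = col4 (- v 0 0) (2 * v 0 0 + v 1 0) (- v 2 0) (v 3 0)) *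
   (para2 *m v = col4 (v 3 0) (v 2 0 - v 3 0) (v 0 0 + v 1 0) (v 0 0)) *
   (para3 *m v = col4 (- v 3 0) (v 2 0 + v 3 0) (- v 0 0 - v 1 0) (v 0 0))) *
  ((para1^T *m v = col4 (2 * v 1 0 - v 0 0) (v 1 0) (- v 2 0) (v 3 0)) *
   (para2^T *m v = col4 (v 2 0 + v 3 0) (v 2 0) (v 1 0) (v 0 0 - v 1 0)) *
   (para3^T *m v = col4 (v 3 0 - v 2 0) (- v 2 0) (v 1 0) (v 1 0 - v 0 0))) *
  ((metric *m v = col4 (2 * v 0 0 + v 1 0) (v 0 0) (- v 3 0) (- v 2 0)) *
   (metric_inv *m v = col4 (v 1 0) (v 0 0 - 2 * v 1 0) (- v 3 0) (- v 2 0))).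
Proof.
by do !split; apply: colP4; rewrite !(mxE, sum_ord4) /=; ring.
Qed.

Lemma para_relations :
  [/\ para1 *m para1 = 1%:M, para2 *m para2 = 1%:M, para3 *m para3 = - 1%:M,
      para1 *m para2 = para3 & para2 *m para1 = - para3].
Proof.
by split; apply: eq_mulmx_col => v; rewrite ?mulNmx ?mul1mx -?mulmxA !mulmx4E;
  apply: colP4; rewrite !mxE /=; ring.
Qed.

Lemma para_compatible :
  [/\ para1^T *m metric *m para1 = - metric,
      para2^T *m metric *m para2 = - metric
    & para3^T *m metric *m para3 = metric].
Proof.
by split; apply: eq_mulmx_col => v; rewrite ?mulNmx -?mulmxA !mulmx4E;
  apply: colP4; rewrite !mxE /=; ring.
Qed.

Lemma metric_mulV : metric *m metric_inv = 1%:M.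
Proof.
by apply: eq_mulmx_col => v; rewrite mul1mx -mulmxA !mulmx4E; apply: colP4;
  rewrite !col4E; ring.
Qed.

(** The k-th matrix is that of minus the differential of the k-th coframe element; entries of
    explicit matrices evaluate by [mxE]. *)
Definition structure_mx k : 'M[R]_4 := mx4 (nth [::] [::
  [:: [:: 0; 0; 0; 1]; [:: 0; 0; 0; 0]; [:: 0; 0; 0; 0]; [:: -1; 0; 0; 0]];
  [:: [:: 0; 0; 0; 0]; [:: 0; 0; 0; -1]; [:: 0; 0; 0; 0]; [:: 0; 1; 0; 0]];
  [:: [:: 0; 1; 0; 0]; [:: -1; 0; 0; 0]; [:: 0; 0; 0; 0]; [:: 0; 0; 0; 0]];
  [:: [:: 0; 0; 0; 0]; [:: 0; 0; 0; 0]; [:: 0; 0; 0; 0]; [:: 0; 0; 0; 0]]] k).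

Lemma sol4_lieE u v : sol4_lie u v =
  col4 (u 0 0 * v 3 0 - u 3 0 * v 0 0) (u 3 0 * v 1 0 - u 1 0 * v 3 0)
       (u 0 0 * v 1 0 - u 1 0 * v 0 0) 0.
Proof.
have cE i j k : sol4_cst i j k = structure_mx k i j.
  by move: i j k; elim/ord4_ind; elim/ord4_ind; elim/ord4_ind; rewrite !mxE.
apply/colP => k; rewrite mxE; under eq_bigr do under eq_bigr do rewrite cE.
by move: k; elim/ord4_ind; rewrite !sum_ord4 !mxE /=; ring.
Qed.

Lemma sol4_lie_delta i j k :
  sol4_lie (delta_mx i 0) (delta_mx j 0) k 0 = sol4_cst i j k :> R.
Proof.
rewrite mxE (bigD1 i)//= (bigD1 j)//= big1 => [|j' /negbTE j'j]; last first.
  by rewrite [delta_mx j 0 _ _]mxE j'j mulr0 mul0r.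
rewrite big1 => [|i' /negbTE i'i]; last first.
  by rewrite big1// => j' _; rewrite [delta_mx i 0 _ _]mxE i'i !mul0r.
by rewrite !mxE !eqxx !mul1r !addr0.
Qed.

Definition lie_integrable (A : 'M[R]_4) := forall u v,
  sol4_lie (A *m u) (A *m v) - A *m sol4_lie (A *m u) v
  - A *m sol4_lie u (A *m v) + A *m (A *m sol4_lie u v) = 0.

Lemma para_integrable :
  [/\ lie_integrable para1, lie_integrable para2 & lie_integrable para3].
Proof.
by split=> u v; rewrite !(mulmx4E, sol4_lieE) !col4E; apply: colP4;
  rewrite !mxE /=; ring.
Qed.

Definition pairing u v : R :=
  2 * (u 0 0 * v 0 0) + u 0 0 * v 1 0 + u 1 0 * v 0 0
  - u 2 0 * v 3 0 - u 3 0 * v 2 0.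

Lemma pairing_delta u l : \sum_k u k 0 * metric k l = pairing u (delta_mx l 0).
Proof.
by move: l; elim/ord4_ind; rewrite sum_ord4 /pairing !mxE /=; ring.
Qed.

Lemma metricE i j : metric i j = pairing (delta_mx i 0) (delta_mx j 0).
Proof.
rewrite -pairing_delta (bigD1 i)//= big1 => [|k /negbTE ki].
  by rewrite [delta_mx _ _ _ _]mxE !eqxx mul1r addr0.
by rewrite [delta_mx _ _ _ _]mxE ki mul0r.
Qed.

(* The connection of [phi *: metric] at a point where [d phi = t * phi * dw]. *)
Definition nabla t u v := col4
  ((1 + t) / 2 * (u 0 0 * v 3 0) - (1 - t) / 2 * (u 3 0 * v 0 0))
  (u 0 0 * v 3 0 + u 3 0 * v 0 0 - (1 - t) / 2 * (u 1 0 * v 3 0)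
   + (1 + t) / 2 * (u 3 0 * v 1 0))
  ((2 + t) * (u 0 0 * v 0 0) + (1 + t) / 2 * (u 0 0 * v 1 0)
   - (1 - t) / 2 * (u 1 0 * v 0 0))
  (t * (u 3 0 * v 3 0)).

(** This is Koszul's formula for the rescaled metric, divided by phi: the derivative of phi along u
    is t phi w(u). It determines [nabla] because the metric is nondegenerate. *)
Lemma pairing_nabla t u v w : pairing (nabla t u v) w = 2^-1 *
  (t * u 3 0 * pairing v w + t * v 3 0 * pairing u w - t * w 3 0 * pairing u v
   + (pairing (sol4_lie u v) w - pairing (sol4_lie u w) v
      - pairing (sol4_lie v w) u)).
Proof. by rewrite !sol4_lieE /pairing !col4E; field. Qed.

(** The value t = -1 belongs to phi = exp(-w), the hypersymplectic rescaling. *)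
Lemma nabla_para u v :
  [/\ nabla (-1) u (para1 *m v) = para1 *m nabla (-1) u v,
      nabla (-1) u (para2 *m v) = para2 *m nabla (-1) u v
    & nabla (-1) u (para3 *m v) = para3 *m nabla (-1) u v].
Proof.
by split; rewrite !mulmx4E !col4E; apply: colP4; rewrite !col4E; field.
Qed.

(** The curvature depends on its first two arguments only through the 2-forms x^w and y^w. *)
Definition area_xw u v := u 0 0 * v 3 0 - u 3 0 * v 0 0.
Definition area_yw u v := u 1 0 * v 3 0 - u 3 0 * v 1 0.

Definition lie_curvature u v w := nabla 0 u (nabla 0 v w)
  - nabla 0 v (nabla 0 u w) - nabla 0 (sol4_lie u v) w.

Lemma lie_curvatureE u v w : lie_curvature u v w = col4
  (- (area_xw u v * w 3 0 / 4))
  (- (2 * area_xw u v * w 3 0) - area_yw u v * w 3 0 / 4)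
  (- (5 * area_xw u v * w 0 0 / 2) - area_xw u v * w 1 0 / 4
   - area_yw u v * w 0 0 / 4) 0.
Proof.
rewrite /lie_curvature sol4_lieE /area_xw /area_yw /nabla !col4E.
by apply: colP4; rewrite !mxE /=; field.
Qed.

(** The Ricci tensor is -1/2 times the square of the 1-form w. Since w is null for the inverse
    metric, the scalar curvature vanishes. *)
Lemma lie_ricci j k :
  \sum_i lie_curvature (delta_mx i 0) (delta_mx j 0) (delta_mx k 0) i 0 =
  - (2^-1 * ((delta_mx j 0 : 'cV[R]_4) 3 0 * (delta_mx k 0 : 'cV[R]_4) 3 0)).
Proof.
move: (delta_mx j 0) (delta_mx k 0) => u v; rewrite sum_ord4 !lie_curvatureE.
by rewrite !col4E /area_xw /area_yw !mxE /=; field.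
Qed.

(** The factor 1/4 is the 1/2 in the definition of the Weyl tensor times the 1/2 of [lie_ricci]. The
    Ricci part absorbs all terms with y^w. *)
Lemma lie_weyl u v w z :
  pairing (lie_curvature u v w) z
  + 4^-1 * (pairing u z * (v 3 0 * w 3 0) - pairing u w * (v 3 0 * z 3 0)
      + pairing v w * (u 3 0 * z 3 0) - pairing v z * (u 3 0 * w 3 0))
  = 2 * (area_xw u v * area_xw w z).
Proof.
by rewrite lie_curvatureE /pairing !col4E /area_xw /area_yw; field.
Qed.

End LieAlgebra.

(** * Transfer from the Lie algebra to the quotient, with a conformal factor *)

Section Conformal.
Context {R : realType} {Gamma : discrete_subgroup R}.
Local Notation M := (sol4_quotient Gamma).
Local Notation proj := (sol4_proj Gamma).
Implicit Types (phi : M -> R) (x : M) (U : set M) (t : R).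

Lemma nabla_delta t (u v : 'cV[R]_4) k :
  \sum_i \sum_j u i 0 * v j 0 * nabla t (delta_mx i 0) (delta_mx j 0) k 0 =
  nabla t u v k 0.
Proof.
by rewrite !sum_ord4; move: k; elim/ord4_ind; rewrite !col4E !mxE /=; field.
Qed.

Lemma metric_unit : (metric : 'M[R]_4) \in unitmx.
Proof. by have [] := mulmx1_unit (@metric_mulV R). Qed.

Lemma metric_tr : metric^T = metric :> 'M[R]_4.
Proof.
apply/matrixP => i j; rewrite mxE.
by move: i j; elim/ord4_ind; elim/ord4_ind; rewrite !mxE.
Qed.

(** On frame vectors both sides have the same pairings, by [koszul_conformal_cst] and
    [pairing_nabla]; inverting the metric and bilinearity give the rest. Only the first derivatives
    of phi at x enter, so the lemma also applies at a critical point, with t = 0. *)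
Lemma connection_conformal phi t x (u v : 'cV[R]_4) : phi x != 0 ->
  (forall i, derivable (phi \o proj) (repr x) (frame i (repr x))) ->
  (forall i, frame_der i phi x = t * phi x * (i == 3)%:R) ->
  connection (fun y => phi y *: metric) x u v = nabla t u v.
Proof.
move=> phi0 dphi Dphi.
have lieE i j l : \sum_k sol4_cst i j k * metric k l =
    pairing (sol4_lie (delta_mx i 0) (delta_mx j 0)) (delta_mx l 0) :> R.
  by rewrite -pairing_delta; apply: eq_bigr => k _; rewrite sol4_lie_delta.
have E i j : \row_l koszul (fun y => phi y *: metric) i j l x =
    (nabla t (delta_mx i 0) (delta_mx j 0))^T *m (phi x *: metric).
  apply/rowP => l; rewrite mxE koszul_conformal_cst// !Dphi !lieE !metricE.
  rewrite -scalemxAr mxE mxE; under eq_bigr do rewrite mxE.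
  rewrite pairing_delta pairing_nabla.
  have d3 k : (delta_mx k 0 : 'cV[R]_4) 3 0 = (k == 3)%:R.
    by rewrite mxE andbT eq_sym.
  by rewrite !d3; ring.
have gu : phi x *: metric \in unitmx by rewrite unitmxZ ?unitfE// metric_unit.
apply/colP => k; rewrite mxE -nabla_delta; apply: eq_bigr => i _.
apply: eq_bigr => j _; congr (_ * _).
transitivity ((\row_l koszul (fun y => phi y *: metric) i j l x *m
  invmx (phi x *: metric)) 0 k); last by rewrite E mulmxK// mxE.
by rewrite mxE; apply: eq_bigr => l _; rewrite mxE.
Qed.

Lemma connection_metric x (u v : 'cV[R]_4) :
  connection (fun=> metric) x u v = nabla 0 u v.
Proof.
rewrite -(@connection_conformal (fun=> 1) 0 x) ?oner_eq0//.
- by congr (connection _ x u v); apply/funext => y; rewrite scale1r.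
- by move=> i; exact: derivable_cst.
- by move=> i; rewrite frame_der_cst !mul0r.
Qed.

Lemma curvature_metric (u v w : 'cV[R]_4) x :
  curvature (fun=> metric) (fun=> u) (fun=> v) (fun=> w) x =
  lie_curvature u v w.
Proof.
have L (a b : 'cV[R]_4) : levi_civita (fun=> metric) (fun=> a) (fun=> b) =
    (fun=> nabla 0 a b) :> (M -> _).
  by apply/funext => y; rewrite levi_civita_cst connection_metric.
by rewrite /curvature bracket_cst !L.
Qed.

Lemma weyl_metric i j k l x : weyl (fun=> metric) i j k l x =
  2 * ((area_xw (delta_mx i 0) (delta_mx j 0) : R) *
       area_xw (delta_mx k 0) (delta_mx l 0)).
Proof.
have ricciE j' k' : ricci (fun=> metric) j' k' x = - (2^-1 *
    ((delta_mx j' 0 : 'cV[R]_4) 3 0 * (delta_mx k' 0 : 'cV[R]_4) 3 0)).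
  rewrite -lie_ricci; apply: eq_bigr => i' _.
  by rewrite -(curvature_metric _ _ _ x).
have scalarE : scalar_curvature (fun=> metric) x = 0.
  rewrite /scalar_curvature.
  have -> : invmx metric = metric_inv :> 'M[R]_4.
    by rewrite -[LHS]mulmx1 -metric_mulV mulKmx// metric_unit.
  apply: big1 => j' _; apply: big1 => k' _; rewrite ricciE.
  by move: j' k'; elim/ord4_ind; elim/ord4_ind; rewrite !mxE /=; ring.
have riemannE : riemann (fun=> metric) i j k l x = pairing (lie_curvature
    (delta_mx i 0) (delta_mx j 0) (delta_mx k 0)) (delta_mx l 0).
  by rewrite -pairing_delta; apply: eq_bigr => m _; rewrite curvature_metric.
rewrite /weyl riemannE scalarE !ricciE !metricE -lie_weyl.
by field.
Qed.

(** The factor phi lets one statement cover both the metric itself and its local rescalings. *)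
Lemma para_hyper_paraHermitian U phi : open U ->
  locally_exp_affine (proj @^-1` U) (phi \o proj) ->
  (forall x, U x -> phi x != 0) ->
  hyper_paraHermitian U (fun=> para1) (fun=> para2) (fun=> para3)
    (fun y => phi y *: metric).
Proof.
move=> oU sphi phi0; split.
- split; first by split; exact: smooth_mx_on_cst.
  split; first by move=> x _; exact: para_relations.
  by have [I1 I2 I3] := @para_integrable R; split; exact: integrable_endo_cst.
- split=> [i j|x]; last first.
    rewrite inE => Ux; split; first by rewrite linearZ/= metric_tr.
    by rewrite unitmxZ ?unitfE ?phi0// metric_unit.
  rewrite (_ : (fun x => _) = fun x => phi x * metric i j); last first.
    by apply/funext => x; rewrite mxE.
  apply: smooth_on_locally_exp_affine => //.
  exact: (locally_exp_affineM (metric i j) sphi).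
- move=> x _; have [C1 C2 C3] := @para_compatible R.
  by rewrite -!scalemxAr -!scalemxAl C1 C2 C3 scalerN.
Qed.

Lemma para_hyper_paraKahler U phi : open U ->
  locally_exp_affine (proj @^-1` U) (phi \o proj) ->
  (forall x, U x -> phi x != 0) ->
  (forall i x, U x -> frame_der i phi x = - phi x * (i == 3)%:R) ->
  hyper_paraKahler U (fun=> para1) (fun=> para2) (fun=> para3)
    (fun y => phi y *: metric).
Proof.
move=> oU sphi phi0 Dphi; split; first exact: para_hyper_paraHermitian.
have sphi' := smooth_on_locally_exp_affine oU sphi.
have cE x u v : U x ->
    connection (fun y => phi y *: metric) x u v = nabla (-1) u v.
  move=> Ux; apply: connection_conformal; first exact: phi0.
    by move=> i; exact: (smooth_on_derivable_frame oU Ux sphi').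
  by move=> i; rewrite Dphi// mulN1r.
by split; apply/parallel_cstP => // x Ux u v; rewrite !cE//;
  have [] := nabla_para u v.
Qed.

End Conformal.

(** * The Hodge star of the metric and anti-self-duality *)

Section HodgeStar.
Context {R : realType}.

Definition det3_formula {T : nzRingType} (f : nat -> nat -> T) : T :=
  f 0%N 0%N * (f 1%N 1%N * f 2%N 2%N - f 1%N 2%N * f 2%N 1%N)
  - f 0%N 1%N * (f 1%N 0%N * f 2%N 2%N - f 1%N 2%N * f 2%N 0%N)
  + f 0%N 2%N * (f 1%N 0%N * f 2%N 1%N - f 1%N 1%N * f 2%N 0%N).

Lemma det_mx3 (T : comNzRingType) (f : nat -> nat -> T) :
  \det (\matrix_(i < 3, j < 3) f i j) = det3_formula f.
Proof.
rewrite (expand_det_row _ ord0) !big_ord_recl big_ord0 /cofactor.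
rewrite !(expand_det_row _ ord0) !big_ord_recl !big_ord0 /cofactor.
by rewrite !det_mx11 !mxE /= /bump /= /det3_formula; ring.
Qed.

Definition det4_formula {T : nzRingType} (f : nat -> nat -> T) : T :=
  let minor j := det3_formula (fun a b => f a.+1 (bump j b)) in
  f 0%N 0%N * minor 0%N - f 0%N 1%N * minor 1%N
  + f 0%N 2%N * minor 2%N - f 0%N 3%N * minor 3%N.

Lemma det_mx4 (T : comNzRingType) (f : nat -> nat -> T) :
  \det (\matrix_(i < 4, j < 4) f i j) = det4_formula f.
Proof.
have minorE (j : 'I_4) :
    \det (row' ord0 (col' j (\matrix_(i < 4, j < 4) f i j))) =
    det3_formula (fun a b => f a.+1 (bump j b)).
  by rewrite -det_mx3; congr (\det _); apply/matrixP => a b; rewrite !mxE.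
rewrite (expand_det_row _ ord0) !big_ord_recl big_ord0 /cofactor !minorE.
rewrite !mxE /=.
by rewrite /det4_formula; move: (det3_formula _) => a; ring.
Qed.

(** Over the integers and with natural number indices, the symbol evaluates by computation. *)
Definition levi_civita_int (i j k l : nat) : int :=
  det4_formula (fun a b => (nth 0%N [:: i; j; k; l] a == b)%:R).

Lemma levi_civita_symbolE (i j k l : 'I_4) :
  levi_civita_symbol i j k l = (levi_civita_int i j k l)%:~R :> R.
Proof.
rewrite /levi_civita_int -det_mx4 -det_map_mx; congr (\det _).
apply/matrixP => a b; rewrite !mxE rmorph_nat; congr ((_ : bool)%:R).
by rewrite (tnth_nth 0); case: a => -[|[|[|[|]]]].
Qed.

(** The 2-form a x^y + b x^z + c x^w + d y^z + e y^w + f z^w. *)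
Definition skew4 (a b c d e f : R) := mx4 [:: [:: 0; a; b; c];
                                             [:: - a; 0; d; e];
                                             [:: - b; - d; 0; f];
                                             [:: - c; - e; - f; 0]].

Lemma skew4_mul a b c d e f (v : 'cV[R]_4) : skew4 a b c d e f *m v = col4
  (a * v 1 0 + b * v 2 0 + c * v 3 0) (- a * v 0 0 + d * v 2 0 + e * v 3 0)
  (- b * v 0 0 - d * v 1 0 + f * v 3 0) (- c * v 0 0 - e * v 1 0 - f * v 2 0).
Proof. by apply: colP4; rewrite !(mxE, sum_ord4) /=; ring. Qed.

Lemma metric_inv_skew4 a b c d e f :
  metric_inv *m skew4 a b c d e f *m metric_inv^T =
  skew4 (- a) (- e) (- d) (2 * e - c) (2 * d - b) (- f).
Proof.
have -> : metric_inv^T = metric_inv :> 'M[R]_4.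
  apply/matrixP => i j; rewrite mxE.
  by move: i j; elim/ord4_ind; elim/ord4_ind; rewrite !mxE.
by apply: eq_mulmx_col => v; rewrite -!mulmxA !(mulmx4E, skew4_mul) !col4E;
  apply: colP4; rewrite !col4E; ring.
Qed.

(** The determinant of the metric is 1, so the star raises both indices and then exchanges
    complementary pairs up to sign. It fixes F1, F2, F3 and negates x^w. *)
Lemma hodge_metric a b c d e f :
  hodge false metric (skew4 a b c d e f) =
  skew4 (- f) (b - 2 * d) (2 * e - c) (- d) e (- a).
Proof.
rewrite /hodge expr0.
have -> : \det metric = 1 :> R.
  rewrite (det_mx4 (fun a b => (nth [::] _ a)`_b)).
  by rewrite /det4_formula /det3_formula /=; ring.
rewrite normr1 sqrtr1.
have -> : invmx metric = metric_inv :> 'M[R]_4.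
  by rewrite -[LHS]mulmx1 -metric_mulV mulKmx// metric_unit.
rewrite metric_inv_skew4; apply/matrixP => i j; rewrite mxE.
under eq_bigr do under eq_bigr do rewrite levi_civita_symbolE !mul1r.
rewrite !sum_ord4.
move: i j; elim/ord4_ind; elim/ord4_ind.
(* Every symbol in the sixteen entries is replaced by its integer value. *)
all: repeat match goal with |- context [levi_civita_int ?a ?b ?c ?d] =>
  let v := eval vm_compute in (levi_civita_int a b c d) in
  change (levi_civita_int a b c d) with v end.
all: rewrite !mxE /= ?(mulr0z, mulr1z, mulrN1z).
all: by field.
Qed.

Lemma hodgeZ (o : bool) (h F : 'M[R]_4) (r : R) :
  hodge o h (r *: F) = r *: hodge o h F.
Proof.
rewrite /hodge -scalemxAr -scalemxAl; move: (_ *m _) => U.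
apply/matrixP => i j; rewrite !mxE mulrCA; congr (_ * _).
rewrite mulr_sumr; apply: eq_bigr => k _.
rewrite mulr_sumr; apply: eq_bigr => l _.
by rewrite mxE mulrCA.
Qed.

Lemma para_form : [/\ metric *m para1 = skew4 1 0 0 0 0 (-1),
    metric *m para2 = skew4 0 1 1 0 1 0
  & metric *m para3 = skew4 0 1 (-1) 0 (-1) 0].
Proof.
by split; apply: eq_mulmx_col => v; rewrite -mulmxA !(mulmx4E, skew4_mul);
  apply: colP4; rewrite !col4E; ring.
Qed.

(** The forms are self-dual when (X,Y,Z,W) is positive. For fixed last indices the Weyl tensor is a
    multiple of x^w, which the star negates, so the two terms of [weyl_plus] cancel. *)
Lemma para_anti_self_dual (Gamma : discrete_subgroup R) :
  anti_self_dual (Gamma := Gamma) (fun=> para1) (fun=> para2) (fun=> para3)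
    (fun=> metric).
Proof.
exists false; split=> [x|i j k l x].
  have [f1 f2 f3] := para_form; rewrite /self_dual /fundamental_form f1 f2 f3.
  by split; rewrite hodge_metric; congr (skew4 _ _ _ _ _ _); ring.
pose area (p q : 'I_4) : R := area_xw (delta_mx p 0) (delta_mx q 0).
have areaE : \matrix_(p, q) area p q = skew4 0 0 1 0 0 0.
  apply/matrixP => p q; rewrite !mxE /area.
  by move: p q; elim/ord4_ind; elim/ord4_ind; rewrite /area_xw !mxE /=; ring.
rewrite /weyl_plus.
rewrite (_ : \matrix_(p, q) _ = (2 * area k l) *: \matrix_(p, q) area p q).
  rewrite hodgeZ areaE hodge_metric weyl_metric.
  rewrite (_ : skew4 _ _ _ _ _ _ = - skew4 0 0 1 0 0 0).
    by rewrite -areaE !mxE -/(area i j) -/(area k l); ring.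
  by apply/matrixP; elim/ord4_ind; elim/ord4_ind; rewrite !mxE /=; ring.
apply/matrixP => p q; rewrite !mxE weyl_metric -/(area p q) -/(area k l).
by ring.
Qed.

End HodgeStar.

(** * The projection as a covering and the local coordinate w *)

Section Covering.
Context {R : realType}.
Implicit Types p q a : 'rV[R]_4.

Lemma cvg_row4 T (F : set_system T) (FF : Filter F) (f0 f1 f2 f3 : T -> R)
    (l0 l1 l2 l3 : R) :
  f0 @ F --> l0 -> f1 @ F --> l1 -> f2 @ F --> l2 -> f3 @ F --> l3 ->
  row4 (f0 t) (f1 t) (f2 t) (f3 t) @[t --> F] --> row4 l0 l1 l2 l3.
Proof.
move=> h0 h1 h2 h3 A [P lP PA].
suff : \forall t \near F, A (row4 (f0 t) (f1 t) (f2 t) (f3 t)) by [].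
have [P0 P1 P2 P3] : [/\ nbhs l0 (P 0 0), nbhs l1 (P 0 1), nbhs l2 (P 0 2)
    & nbhs l3 (P 0 3)].
  by split; have := lP 0; [move/(_ 0)|move/(_ 1)|move/(_ 2)|move/(_ 3)];
    rewrite row4E.
near=> t; apply: PA => i; rewrite !ord1; elim/ord4_ind; rewrite row4E; near: t.
- exact: h0.
- exact: h1.
- exact: h2.
- exact: h3.
Unshelve. all: by end_near. Qed.

Lemma cvg_coord T (F : set_system T) (FF : Filter F) (f : T -> 'rV[R]_4) p j :
  f @ F --> p -> f t 0 j @[t --> F] --> p 0 j.
Proof.
by move=> fp; exact: (cvg_comp _ _ fp (@coord_continuous R 1 4 0 j p)).
Qed.

Lemma cvg_expR T (F : set_system T) (FF : Filter F) (f : T -> R) l :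
  f @ F --> l -> expR (f t) @[t --> F] --> expR l.
Proof. by move=> fl; exact: (cvg_comp _ _ fl (@continuous_expR R l)). Qed.

Lemma cvg_sol4_mul T (F : set_system T) (FF : Filter F) (f g : T -> 'rV[R]_4)
    p q :
  f @ F --> p -> g @ F --> q ->
  sol4_mul (f t) (g t) @[t --> F] --> sol4_mul p q.
Proof.
move=> fp gq; have cf := @cvg_coord T F FF f p ^~ fp.
have cg := @cvg_coord T F FF g q ^~ gq.
have e3 := cvg_expR FF (cf 3).
have eN3 : expR (- f t 0 3) @[t --> F] --> expR (- p 0 3).
  exact: (cvg_expR FF (cvgN (cf 3))).
apply: cvg_row4;
  [apply: cvgD|apply: cvgD|apply: cvgD|exact: (cvgD (cf 3) (cg 3))].
- exact: cf.
- exact: (cvgM eN3 (cg 0)).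
- exact: cf.
- exact: (cvgM e3 (cg 1)).
- exact: (cvgD (cf 2) (cg 2)).
- exact: (cvgM (cvgM e3 (cf 0)) (cg 1)).
Qed.

Lemma cvg_sol4_inv T (F : set_system T) (FF : Filter F) (f : T -> 'rV[R]_4) p :
  f @ F --> p -> sol4_inv (f t) @[t --> F] --> sol4_inv p.
Proof.
move=> fp; have cf := @cvg_coord T F FF f p ^~ fp.
have e3 := cvg_expR FF (cf 3).
have eN3 : expR (- f t 0 3) @[t --> F] --> expR (- p 0 3).
  exact: (cvg_expR FF (cvgN (cf 3))).
apply: cvg_row4; [apply: cvgN|apply: cvgN|apply: cvgB|exact: (cvgN (cf 3))].
- exact: (cvgM e3 (cf 0)).
- exact: (cvgM eN3 (cf 1)).
- exact: (cvgM (cf 0) (cf 1)).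
- exact: cf.
Qed.

Context (Gamma : discrete_subgroup R).
Local Notation M := (sol4_quotient Gamma).
Local Notation proj := (sol4_proj Gamma).

(** The map (q, r) -> r q^{-1} is continuous with value 1 at (p, p), and 1 is isolated in Gamma.
    Hence a = (a q) q^{-1} is 1 as soon as q and a q are close to p. The projection is therefore
    injective on V. *)
Lemma small_neighborhood p : exists V : set 'rV[R]_4, [/\ open V, V p &
  forall q a, V q -> dsubgroup_set Gamma a -> V (sol4_mul a q) -> a = sol4_one].
Proof.
have [_ [N N1 NG]] := dsubgroup_discrete (dsubgroup_one Gamma).
have : sol4_mul st.2 (sol4_inv st.1) @[st --> (p, p)] --> sol4_one.
  rewrite -(sol4_mulV p).
  apply: cvg_sol4_mul; [exact: cvg_snd|apply: cvg_sol4_inv; exact: cvg_fst].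
move=> /(_ _ N1) [[A B]/= [pA pB] ABN].
exists (A `&` B)°; split; first exact: open_interior.
  exact: filterI.
move=> q a /interior_subset[Aq _] Ga /interior_subset[_ Baq].
have := ABN (q, sol4_mul a q) (conj Aq Baq).
rewrite /= -sol4_mulA sol4_mulV sol4_mul1 => Na.
by have : (N `&` dsubgroup_set Gamma) a by []; rewrite NG.
Qed.

Lemma proj_image_translate (V : set 'rV[R]_4) p :
  open V -> (proj @` V) (proj p) ->
  exists2 a, dsubgroup_set Gamma a & \forall q \near p, V (sol4_mul a q).
Proof.
move=> oV [q Vq /sol4_proj_eq[a Ga pE]].
exists (sol4_inv a); first exact: dsubgroup_inv.
have : sol4_mul (sol4_inv a) r @[r --> p] --> q.
  rewrite -(sol4_1mul q) -(sol4_mulVl a) -sol4_mulA -pE.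
  apply: (@cvg_sol4_mul _ (nbhs p) _ (fun=> sol4_inv a) id _ _ _ cvg_id).
  exact: cvg_cst.
by apply; exact: open_nbhs_nbhs.
Qed.

Lemma open_proj_image (V : set 'rV[R]_4) : open V -> open (proj @` V).
Proof.
move=> oV; suff : open (proj @^-1` (proj @` V)) by [].
rewrite openE => p /(proj_image_translate oV)[a Ga]; apply: filterS => q Vaq.
by exists (sol4_mul a q) => //; apply/esym/sol4_proj_eq; exists a.
Qed.

Lemma local_coordinate (x : M) : exists U (u : M -> R), [/\ open U, U x &
  forall p, U (proj p) ->
    exists c : R, \forall q \near p, u (proj q) = c - q 0 3].
Proof.
have [V [oV Vx VG]] := small_neighborhood (repr x).
(* The default value 0 of [xget] is taken only outside the image of V. *)
pose u (m : M) : R := - (xget 0 [set q | V q /\ proj q = m]) 0 3.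
exists (proj @` V), u; split; first exact: open_proj_image.
  by exists (repr x); rewrite ?sol4_projK.
move=> p /(proj_image_translate oV)[a Ga near_V].
exists (- a 0 3); move: near_V; apply: filterS => q Vaq.
have projE : proj (sol4_mul a q) = proj q by apply/esym/sol4_proj_eq; exists a.
(* The chosen preimage s and [sol4_mul a q] lie in V and in one coset, so they coincide by the
   choice of V. *)
rewrite /u; case: xgetP => [s _ [Vs sq]|/(_ (sol4_mul a q))]; last by case.
have /sol4_proj_eq[b Gb sE] : proj (sol4_mul a q) = proj s by rewrite projE.
rewrite sE in Vs; rewrite sE (VG _ _ Vaq Gb Vs) sol4_1mul.
by rewrite !row4E opprD.
Qed.
End Covering.

(** If the derivative D were nonzero, all difference quotients with small increments would have the
    sign of D; at a maximum they have opposite weak signs for positive and negative increments. *)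
Lemma derive_at_max {R : realType} {V : normedModType R} (f : V -> R)
    (p v : V) :
  derivable f p v -> (forall q, f q <= f p) -> 'D_v f p = 0.
Proof.
move=> dfv fmax; apply: contrapT => /eqP D0.
pose q (h : R) : R := h^-1 * (f (h *: v + p) - f p).
have : q h * 'D_v f p @[h --> 0^'] --> 'D_v f p * 'D_v f p.
  by apply: cvgMl; exact: dfv.
have DD : 0 < 'D_v f p * 'D_v f p by rewrite -expr2 exprn_even_gt0.
move=> /(cvgr_gt _)/(_ _ DD) [e/= e0 qD].
have qs h : `|h| < e -> h != 0 -> 0 < q h * 'D_v f p.
  by move=> he h0; apply: qD => //=; rewrite sub0r normrN.
have e20 : 0 < e / 2 by rewrite divr_gt0.
have e2e : e / 2 < e by rewrite gtr_pMr// invf_lt1// ltr1n.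
have := qs (e / 2); rewrite gtr0_norm// gt_eqF// => /(_ e2e isT) qp.
have := qs (- (e / 2)); rewrite normrN gtr0_norm// oppr_eq0 gt_eqF//.
move=> /(_ e2e isT) qn.
have qp0 : q (e / 2) <= 0.
  by rewrite /q pmulr_rle0 ?invr_gt0// subr_le0.
have qn0 : 0 <= q (- (e / 2)).
  by rewrite /q nmulr_rge0 ?invr_lt0 ?oppr_lt0// subr_le0.
have [Dp|Dn] := ltP 0 ('D_v f p).
  by move: qp; rewrite pmulr_lgt0// ltNge qp0.
move: qn; rewrite ltNge => /negP; apply.
exact: mulr_ge0_le0.
Qed.

(** * Local existence and global obstruction for the conformal factor *)

Section ConformallyKahler.
Context {R : realType} {Gamma : discrete_subgroup R}.
Local Notation M := (sol4_quotient Gamma).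
Local Notation proj := (sol4_proj Gamma).
Implicit Types (u : M -> R) (x : M).

Lemma frame_w (i : 'I_4) (p : 'rV[R]_4) : (frame i p) 0 3 = (i == 3)%:R.
Proof.
have [f0 f1 f2 f3] := frame_expr p.
by move: i; elim/ord4_ind; rewrite ?f0 ?f1 ?f2 ?f3 row4E.
Qed.

Lemma para_locally_conformally_hyper_paraKahler :
  locally_conformally_hyper_paraKahler (fun=> para1) (fun=> para2) (fun=> para3)
    (fun=> metric : 'M[R]_4) (Gamma := Gamma).
Proof.
move=> x; have [U [u [oU Ux uE]]] := local_coordinate x.
exists U; split=> //; exists u.
  apply: smooth_on_locally_exp_affine => // p /uE[c E].
  exists (-1), c, 0; apply: filterS E => q /= ->.
  by rewrite /exp_affine; ring.
have expE p : U (proj p) -> exists c,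
    {near p, (expR \o u) \o proj =1 exp_affine 0 0 c}.
  move=> /uE[c E]; exists (expR c); apply: filterS E => q /= ->.
  by rewrite /exp_affine expRD; ring.
apply: (@para_hyper_paraKahler _ _ U (expR \o u)) => //.
- by move=> p /expE[c E]; exists 0, 0, c.
- by move=> y _; rewrite gt_eqF// expR_gt0.
(* Near a lift of y the factor is c exp(-w), so its derivative along the i-th field is minus itself
   times w of that field. *)
move=> i y Uy; have [|c E] := expE (repr y); first by rewrite sol4_projK.
rewrite /frame_der (near_eq_derive _ E).
have [_ ->] := is_derive_exp_affine 0 0 c (repr y) (frame i (repr y)).
have /= := nbhs_singleton E; rewrite sol4_projK => ->.
by rewrite frame_w /exp_affine; ring.
Qed.

Lemma para_not_globally_conformally_hyper_paraKahler :
  compact [set: M] ->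
  ~ globally_conformally_hyper_paraKahler (fun=> para1) (fun=> para2)
    (fun=> para3) (fun=> metric : 'M[R]_4) (Gamma := Gamma).
Proof.
move=> cM [u su [_ [p1 _ _]]].
have cu : continuous u.
  apply/quotient_continuous => p; have [+ _] := su 0%N; apply; exact: in_setT.
have M0 : [set: M] !=set0 by exists (proj 0).
have [x _ xmax] := compact_EVT_max M0 cM (continuous_subspaceT cu).
have De i : is_derive (repr x) (frame i (repr x)) ((expR \o u) \o proj) 0.
  have Du := smooth_on_derivable_frame (i := i) openT (I : setT x) su.
  have D0 : 'D_(frame i (repr x)) (u \o proj) (repr x) = 0.
    apply: derive_at_max Du _ => q.
    by rewrite /= sol4_projK; apply: xmax; exact: in_setT.
  have := derivableP Du; rewrite D0.
  rewrite -{1 3}[repr x]add0r -(scale0r (frame i (repr x))).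
  move=> /is_derive_lineP d1.
  apply/is_derive_lineP.
  have := is_derive1_comp (is_derive_expR _) d1.
  by rewrite mulr0.
have cE (v w : 'cV[R]_4) : connection (conformal_change u (fun=> metric)) x v w
    = nabla 0 v w.
  apply: (@connection_conformal _ _ (expR \o u)).
  - by rewrite gt_eqF// expR_gt0.
  - by move=> i; have [] := De i.
  - by move=> i; have [_] := De i; rewrite /frame_der !mul0r.
(* On X and W: J1 W = W and nabla_X W = X/2 + Y, but J1 (X/2 + Y) = -X/2 + 2 Y; the X components
   differ. *)
have := (parallel_cstP _ _ openT).1 p1 x I (delta_mx 0 0) (delta_mx 3 0).
rewrite !cE !mulmx4E => /colP/(_ 0); rewrite !col4E !mxE /=.
lra.
Qed.
End ConformallyKahler.

Theorem theorem1p4 (R : realType) (Gamma : discrete_subgroup R) :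
  compact [set: sol4_quotient Gamma] ->
  exists J1 J2 J3 g : sol4_quotient Gamma -> 'M[R]_4,
    [/\ hyper_paraHermitian setT J1 J2 J3 g,
        anti_self_dual J1 J2 J3 g,
        ~ weyl_flat g,
        locally_conformally_hyper_paraKahler J1 J2 J3 g
      & ~ globally_conformally_hyper_paraKahler J1 J2 J3 g].
Proof.
move=> cM; exists (fun=> para1), (fun=> para2), (fun=> para3), (fun=> metric).
split.
- rewrite (_ : (fun=> metric) = fun y => (1 : R) *: metric); last first.
    by apply/funext => y; rewrite scale1r.
  apply: (@para_hyper_paraHermitian _ _ _ (fun=> 1)); first exact: openT.
    move=> p _; exists 0, 1, 0; apply: (@nearW _ (nbhs p)) => q.
    by rewrite /exp_affine /=; ring.
  by move=> y _; exact: oner_neq0.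
- exact: para_anti_self_dual.
(* On X, W, X, W the Weyl tensor takes the value 2. *)
- move=> /(_ 0 3 0 3 (sol4_proj Gamma 0)); rewrite weyl_metric /area_xw !mxE /=.
  by lra.
- exact: para_locally_conformally_hyper_paraKahler.
- exact: para_not_globally_conformally_hyper_paraKahler.
Qed.
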